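(* Let $a_1,a_2,\ldots,a_n,\ldots$ be an infinite arithmetic progression of real numbers with first term $a_1$ and positive difference $d$, and let $M$ be a natural number such that $a_1\le M$. Then the number of terms of the progression that do not exceed $M$ (that is, the number of indices $n\ge 1$ with $a_n\le M$) is equal to $\left\lfloor \frac{M-a_1}{d}\right\rfloor+1$.
   Context: An arithmetic progression with difference $d$ is a sequence of real numbers satisfying $a_{n+1}=a_n+d$ for every $n$. Natural numbers are the positive integers. $\lfloor x\rfloor$ denotes the integer part of $x$, i.e. the greatest integer not exceeding $x$. *)

(* Defs.v *)
From mathcomp Require Import all_boot all_order all_algebra.
From mathcomp Require Import reals.

Set Implicit Arguments.
Unset Strict Implicit.
Unset Printing Implicit Defensive.

Import GRing.Theory Num.Theory.
Local Open Scope ring_scope.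

(* The terms of the progression are a 1, a 2, ...; the value a 0 is junk,
   hence the guard on n. *)
Definition arithmetic_progression (R : realType) (a : nat -> R) (d : R) : Prop :=
  forall n : nat, (1 <= n)%N -> a n.+1 = a n + d.

(* Main.v *)
Require Import Defs.
From mathcomp Require Import all_boot all_order all_algebra finmap.
From mathcomp Require Import boolp classical_sets cardinality reals.

Set Implicit Arguments.
Unset Strict Implicit.
Unset Printing Implicit Defensive.

Import Order.TTheory GRing.Theory Num.Theory.
Local Open Scope classical_set_scope.
Local Open Scope ring_scope.

(** Since the k-th term after the first is a 1 + k * d and d is positive, it is
    at most a bound x exactly when k <= (x - a 1) / d, that is, k being an
    integer, when k is at most the floor of this quotient
    ([progression_le_floor]).  When a 1 <= x the floor is a natural number m,
    so the admissible k are 0, ..., m, and the admissible indices are the m + 1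
    successors of these. *)

Lemma progressionE (R : realType) (a : nat -> R) (d : R) (k : nat) :
  arithmetic_progression a d -> a k.+1 = a 1%N + k%:R * d.
Proof.
move=> ha; elim: k => [|k IHk]; first by rewrite mul0r addr0.
by rewrite ha// IHk -addrA -natr1 mulrDl mul1r.
Qed.

(** The floor is the largest integer below its argument, so comparing it with
    an integer is comparing the argument itself. *)
Lemma progression_le_floor (R : realType) (a : nat -> R) (d x : R) (k : nat) :
  arithmetic_progression a d -> 0 < d ->
  (a k.+1 <= x) = (k%:Z <= Num.floor ((x - a 1%N) / d)).
Proof.
move=> ha hd.
by rewrite (progressionE k ha) floor_ge_int pmulrn ler_pdivlMr// lerBrDl.
Qed.

Theorem mainTheorem1 (R : realType) (a : nat -> R) (d : R) (M : nat)
    (ha : arithmetic_progression a d) (hd : 0 < d)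
    (hM : (0 < M)%N) (haM : a 1%N <= M%:R) :
  finite_set [set n : nat | (1 <= n)%N /\ a n <= M%:R] /\
  (#|` fset_set [set n : nat | (1 <= n)%N /\ a n <= M%:R]|)%fset%:Z
    = Num.floor ((M%:R - a 1%N) / d) + 1.
Proof.
have le_floor k := progression_le_floor M%:R k ha hd.
(* As the first term is within the bound, the floor is nonnegative. *)
have := haM; rewrite le_floor.
case: (Num.floor _) le_floor => [m|//] le_m _.
have -> : [set n : nat | (1 <= n)%N /\ a n <= M%:R] = succn @` `I_m.+1.
  apply/seteqP; split=> [[|k] [//= _]|_ [k /= km <-]].
    by rewrite le_m lez_nat => km; exists k.
  by rewrite le_m lez_nat.
have card_succ : (succn @` `I_m.+1 #= `I_m.+1)%card.
  by apply: inj_card_eq => i j _ _ [].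
split; first by apply/finite_setP; exists m.+1.
by rewrite (card_fset_set card_succ) -addn1 PoszD.
Qed.
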